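(* Let $(A_\gamma)_{\gamma\in\Gamma}$ be a net of Banach algebras (over the same scalar field $\mathbb{R}$ or $\mathbb{C}$), directed by inclusion, that have equi-uniformly open multiplications. Then the direct limit of $(A_\gamma)_{\gamma\in\Gamma}$ has uniformly open multiplication.
   Context: Directed by inclusion means that $\Gamma$ is a directed set and, for $\gamma\leqslant\gamma'$, $A_\gamma$ is a subalgebra of $A_{\gamma'}$ with the inherited norm; the direct limit is the completion of the normed algebra $\bigcup_{\gamma\in\Gamma}A_\gamma$. With $B(x,r)$ the open ball and $U\cdot V=\{uv\colon u\in U,v\in V\}$, multiplication in a normed algebra $A$ is uniformly open if for every $\varepsilon>0$ there is $\delta>0$ such that $B(xy,\delta)\subseteq B(x,\varepsilon)\cdot B(y,\varepsilon)$ for all $x,y\in A$; the algebras $A_\gamma$ $(\gamma\in\Gamma)$ have equi-uniformly open multiplications if for every $\varepsilon>0$ one $\delta>0$ works simultaneously for all $A_\gamma$. *)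

(* Defs.v *)
From HB Require Import structures.
From mathcomp Require Import all_boot all_order all_algebra.
From mathcomp Require Import complex.
From mathcomp Require Import all_classical all_reals all_analysis.

Set Implicit Arguments.
Unset Strict Implicit.
Unset Printing Implicit Defensive.

Import Order.TTheory GRing.Theory Num.Theory.
Import numFieldNormedType.Exports.

Local Open Scope classical_set_scope.
Local Open Scope ring_scope.

Variant scalar_kind := RealScalars | ComplexScalars.

Definition scalar_field (R : realType) (s : scalar_kind) : numFieldType :=
  match s with
  | RealScalars => R
  | ComplexScalars => R[i]
  end.

(* The product of a normed algebra need be neither unital nor commutative, so
   the ring structures of ssralg (all of them unital) are not used here. *)
HB.mixin Record NormedModule_isNormedAlgebra (K : numFieldType) A
    of NormedModule K A := {
  amul : A -> A -> A ;
  amulA : associative amul ;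
  amulDl : left_distributive amul +%R ;
  amulDr : right_distributive amul +%R ;
  scale_amull : forall (a : K) (x y : A), a *: amul x y = amul (a *: x) y ;
  scale_amulr : forall (a : K) (x y : A), a *: amul x y = amul x (a *: y) ;
  ler_norm_amul : forall x y : A, `|amul x y| <= `|x| * `|y|
}.

#[short(type="normedAlgType")]
HB.structure Definition NormedAlgebra (K : numFieldType) :=
  {A of NormedModule_isNormedAlgebra K A & NormedModule K A}.

#[short(type="banachAlgType")]
HB.structure Definition BanachAlgebra (K : numFieldType) :=
  {A of NormedAlgebra K A & CompleteNormedModule K A}.

(* U . V = {uv : u in U, v in V} *)
Definition setamul (K : numFieldType) (A : normedAlgType K) (U V : set A) :
  set A := [set amul u v | u in U & v in V].

Definition uniformly_open_mul (K : numFieldType) (A : normedAlgType K) :=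
  forall e : K, 0 < e -> exists2 d : K, 0 < d &
    forall x y : A, ball (amul x y) d `<=` setamul (ball x e) (ball y e).

Definition equi_uniformly_open_mul (K : numFieldType) (I : Type)
    (A : I -> normedAlgType K) :=
  forall e : K, 0 < e -> exists2 d : K, 0 < d &
    forall (i : I) (x y : A i),
      ball (amul x y) d `<=` setamul (ball x e) (ball y e).

(* Since distinct types are disjoint, "A is a subalgebra of B with the
   inherited norm" is expressed by an inclusion map A -> B of this kind. *)
Definition isometric_alg_hom (K : numFieldType) (A B : normedAlgType K)
    (f : A -> B) :=
  [/\ linear f, {morph f : x y / amul x y} & forall x : A, `|f x| = `|x|].

Definition directed_set (d : Order.disp_t) (Gamma : preorderType d) :=
  inhabited Gamma /\
  forall g h : Gamma, exists k : Gamma, (g <= k)%O /\ (h <= k)%O.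

Definition directed_by_inclusion (K : numFieldType) (d : Order.disp_t)
    (Gamma : preorderType d) (A : Gamma -> normedAlgType K)
    (inc : forall g h : Gamma, (g <= h)%O -> A g -> A h) :=
  [/\ directed_set Gamma,
      forall (g h : Gamma) (gh : (g <= h)%O), isometric_alg_hom (inc g h gh),
      forall (g : Gamma) (gg : (g <= g)%O) (x : A g), inc g g gg x = x &
      forall (g h k : Gamma) (gh : (g <= h)%O) (hk : (h <= k)%O)
        (gk : (g <= k)%O) (x : A g), inc h k hk (inc g h gh x) = inc g k gk x].

(* U, with the inclusions iota g : A g -> U, is the normed algebra
   \bigcup_g A g. *)
Definition is_union_algebra (K : numFieldType) (d : Order.disp_t)
    (Gamma : preorderType d) (A : Gamma -> normedAlgType K)
    (inc : forall g h : Gamma, (g <= h)%O -> A g -> A h)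
    (U : normedAlgType K) (iota : forall g : Gamma, A g -> U) :=
  [/\ forall g : Gamma, isometric_alg_hom (iota g),
      forall (g h : Gamma) (gh : (g <= h)%O) (x : A g),
        iota h (inc g h gh x) = iota g x &
      \bigcup_(g in [set: Gamma]) range (iota g) = [set: U]].

Definition is_completion (K : numFieldType) (U : normedAlgType K)
    (L : banachAlgType K) (kappa : U -> L) :=
  isometric_alg_hom kappa /\ dense (range kappa).

Definition is_direct_limit (K : numFieldType) (d : Order.disp_t)
    (Gamma : preorderType d) (A : Gamma -> normedAlgType K)
    (inc : forall g h : Gamma, (g <= h)%O -> A g -> A h)
    (L : banachAlgType K) :=
  exists (U : normedAlgType K) (iota : forall g : Gamma, A g -> U)
    (kappa : U -> L), is_union_algebra inc iota /\ is_completion kappa.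

(* Main.v *)
Require Import Defs.
From HB Require Import structures.
From mathcomp Require Import all_boot all_order all_algebra.
From mathcomp Require Import complex.
From mathcomp Require Import all_classical all_reals all_analysis.
From mathcomp Require Import ring.

(* Openness passes to the union because any three of its elements lie in a
   common A_g. For the completion, let x, y, z in L with |xy - z| < d_0. Start
   from (x_0, y_0) close to (x, y) in the dense subalgebra, and correct it
   repeatedly: an element of the subalgebra very close to z is, by openness with
   a tolerance e_n shrinking geometrically, the product of a pair within e_n of
   (x_n, y_n). The corrections are summable, so the pairs converge to factors
   of z that are still within e of x and y. *)

Set Implicit Arguments.
Unset Strict Implicit.
Unset Printing Implicit Defensive.

Import Order.TTheory GRing.Theory Num.Theory.
Import numFieldNormedType.Exports.

Local Open Scope classical_set_scope.
Local Open Scope ring_scope.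

(** * Choice, scalars and telescoping sequences *)

Lemma dependent_sequence (T : Type) (P : nat -> T -> Prop)
    (Q : nat -> T -> T -> Prop) (t0 : T) :
  P 0%N t0 -> (forall n t, P n t -> exists u, P n.+1 u /\ Q n t u) ->
  exists f : nat -> T,
    f 0%N = t0 /\ forall n, P n (f n) /\ Q n (f n) (f n.+1).
Proof.
move=> P0 PQ.
(* The step is made total by a junk value where [P] fails, so that plain choice applies. *)
have /choice[F FP] : forall nt : nat * T, exists u : T,
    P nt.1 nt.2 -> P nt.1.+1 u /\ Q nt.1 nt.2 u.
  move=> [n t] /=; have [Pnt|nPnt] := pselect (P n t); last by exists t.
  by have [u ?] := PQ n t Pnt; exists u.
pose f := fix f n := if n is m.+1 then F (m, f m) else t0.
have Pf n : P n (f n) by elim: n => [//|n /(FP (n, _))[]].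
by exists f; split=> // n; split=> //; have [] := FP (n, _) (Pf n).
Qed.

(** The order of [K] is only partial, but positive elements are real, hence comparable. *)
Lemma exists_pos_le2 (K : numFieldType) (a b : K) :
  0 < a -> 0 < b -> exists c : K, [/\ 0 < c, c <= a & c <= b].
Proof.
move=> a0 b0; have [ab|ba] := real_leP (gtr0_real a0) (gtr0_real b0).
  by exists a.
by exists b; split=> //; exact: ltW.
Qed.

(* Only the archimedean property separates the scalar fields R and R[i] from
   arbitrary ordered fields; R[i] has no archimedean instance in the library. *)
Definition archimedean_scalars (K : numFieldType) :=
  forall a : K, 0 < a -> exists n : nat, a < n%:R.

Lemma scalar_field_archimedean (R : realType) (s : scalar_kind) :
  archimedean_scalars (scalar_field R s).
Proof.
case: s => a /= a0.
  by exists (Num.bound a); apply: archi_boundP; exact: ltW.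
(* A positive complex number has zero imaginary part, which leaves the real case. *)
case: a a0 => a b; rewrite ltcE /= => /andP[/eqP -> a0].
exists (Num.bound a); rewrite -[_%:R](rmorph_nat (real_complex R)) ltcE /= eqxx.
by apply: archi_boundP; exact: ltW.
Qed.

Lemma geometric_lt (K : numFieldType) (c a : K) :
  archimedean_scalars K -> 0 < c -> 0 < a ->
  exists N : nat, forall n, (N <= n)%N -> c / 2 ^+ n < a.
Proof.
move=> archiK c0 a0; have [N caN] := archiK _ (divr_gt0 c0 a0).
exists N => n Nn; rewrite ltr_pdivrMr ?exprn_gt0// mulrC -ltr_pdivrMr//.
apply: (lt_le_trans caN); rewrite -natrX ler_nat.
by rewrite (leq_trans Nn)// ltnW// ltn_expl.
Qed.

(** Bounding each step by a decrement of [r] lets the bounds telescope, with no series involved. *)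
Lemma telescope_norm (K : numFieldType) (V : normedModType K)
    (x : nat -> V) (r : nat -> K) :
  (forall n, `|x n - x n.+1| <= r n - r n.+1) ->
  forall n m, (n <= m)%N -> `|x n - x m| <= r n - r m.
Proof.
move=> xr n m /subnK <-; elim: (m - n)%N => [|k IH].
  by rewrite add0n !subrr normr0.
rewrite addSn -(subrKA (x (k + n)%N) (x n)) (le_trans (ler_normD _ _))//.
by rewrite -(subrKA (r (k + n)%N) (r n)) lerD.
Qed.

Lemma cvg_telescope (K : numFieldType) (V : completeNormedModType K)
    (x : nat -> V) (r : nat -> K) :
  (forall n, 0 < r n) ->
  (forall a, 0 < a -> exists n, r n < a) ->
  (forall n, `|x n - x n.+1| <= r n - r n.+1) ->
  cvg (x @ \oo).
Proof.
move=> r0 rlt /telescope_norm xr; apply/cauchy_cvgP/cauchy_exP => e e0.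
have [N rN] := rlt e e0; exists (x N); exists N => // m /= Nm.
rewrite -ball_normE /=; apply: le_lt_trans (xr _ _ Nm) _.
by rewrite (lt_trans _ rN)// ltrBlDr ltrDl.
Qed.

(** * Continuity of the product, and approximation from a dense set *)

Lemma amulBB (K : numFieldType) (A : normedAlgType K) (x y u v : A) :
  amul x y - amul u v = amul x (y - v) + amul (x - u) v.
Proof.
rewrite -[in LHS](subrK v y) amulDr -addrA; congr (_ + _).
by rewrite -[in LHS](subrK u x) amulDl addrK.
Qed.

Lemma amul_continuous_at (K : numFieldType) (A : normedAlgType K) (x y : A)
    (e : K) : 0 < e ->
  exists2 h : K, 0 < h & forall u v : A,
    `|x - u| < h -> `|y - v| < h -> `|amul x y - amul u v| < e.
Proof.
move=> e0; pose s := `|x| + `|y| + 1.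
have s0 : 0 < s by rewrite ltr_wpDl// addr_ge0.
have se0 : 0 < s + e by rewrite addr_gt0.
(* The product moves by at most [h * s] once [h <= 1]; the denominator [s + e] gives both [h <= 1]
   and [h * s < e]. *)
exists (e / (s + e)); first exact: divr_gt0.
set h := e / (s + e).
have h0 : 0 < h by exact: divr_gt0.
have h1 : h <= 1 by rewrite ler_pdivrMr// mul1r lerDr ltW.
have hs : h * s < e.
  by rewrite /h mulrAC ltr_pdivrMr// ltr_pM2l// ltrDl.
move=> u v xu yv; rewrite amulBB; apply: le_lt_trans hs.
have vy : `|v| <= `|y| + 1.
  rewrite -[v](subKr y) (le_trans (ler_normB _ _))// lerD2l.
  exact: le_trans (ltW yv) h1.
have -> : h * s = `|x| * h + h * (`|y| + 1) by rewrite /s; ring.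
rewrite (le_trans (ler_normD _ _))// lerD// (le_trans (ler_norm_amul _ _))//.
  by rewrite ler_wpM2l// ltW.
by rewrite ler_pM// ltW.
Qed.

Lemma dense_dist (K : numFieldType) (V : normedModType K) (D : set V) :
  dense D -> forall (x : V) (e : K), 0 < e -> exists2 u, D u & `|x - u| < e.
Proof.
move=> denseD x e e0.
have [|u []] := denseD (ball x e) _ (ball_open x e).
  by exists x; exact: ballxx.
by rewrite -ball_normE /=; exists u.
Qed.

(** * From a dense subset to the whole algebra *)

Section OpenOnDenseSubset.
Variables (K : numFieldType) (archiK : archimedean_scalars K).
Variables (L : banachAlgType K) (D : set L).
Hypothesis denseD : dense D.

(** The factors must lie in [D] again, so that corrections can be iterated. *)
Definition factors_nearby (e d : K) := forall x y z : L,
  D x -> D y -> D z -> `|amul x y - z| < d ->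
  exists u v : L,
    [/\ D u, D v, `|x - u| < e, `|y - v| < e & amul u v = z].

Hypothesis openD : forall e : K, 0 < e -> exists2 d : K, 0 < d &
  factors_nearby e d.

(** As [z] may lie outside [D], a point [w] of [D] is factored instead, close enough to [z] to stay
    within [d] of [amul x y] and within [d'] of [z]. *)
Lemma factor_step (e d d' : K) (x y z : L) :
  factors_nearby e d -> 0 < d' -> D x -> D y -> `|amul x y - z| < d ->
  exists u v : L, [/\ D u, D v, `|x - u| < e, `|y - v| < e &
    `|amul u v - z| < d'].
Proof.
move=> ed d'0 Dx Dy xyz.
have room : 0 < d - `|amul x y - z| by rewrite subr_gt0.
have [c [c0 cl cd']] := exists_pos_le2 room d'0.
have [w Dw zw] := dense_dist denseD z c0.
have [|u [v [Du Dv xu yv uvw]]] := ed x y w Dx Dy Dw.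
  rewrite -(subrKA z) (le_lt_trans (ler_normD _ _))// -ltrBrDl.
  exact: lt_le_trans zw cl.
by exists u, v; split=> //; rewrite uvw distrC (lt_le_trans zw).
Qed.

Lemma uniformly_open_mul_dense : uniformly_open_mul L.
Proof.
move=> e e0.
(* Correction [n] has tolerance [r n.+1]; since [r n - r n.+1 = r n.+1], all corrections together
   cost at most [r 0 = e / 2]. *)
pose r n : K := e / 2 / 2 ^+ n.
have r0 n : 0 < r n by rewrite !divr_gt0// exprn_gt0.
have rS n : r n - r n.+1 = r n.+1.
  by rewrite /r exprS; field; rewrite expf_neq0 ?pnatr_eq0.
have rlt a : 0 < a -> exists N : nat, forall n, (N <= n)%N -> r n < a.
  by move=> a0; exact: geometric_lt archiK (divr_gt0 e0 _) a0.
(* The bound [d n <= r n] forces the errors of the products to tend to 0. *)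
have /choice[d dP] n : exists d : K,
    [/\ 0 < d, d <= r n & factors_nearby (r n.+1) d].
  have [d d0 dP] := openD (r0 n.+1).
  have [c [c0 cd cr]] := exists_pos_le2 d0 (r0 n); exists c; split=> //.
  by move=> x y z Dx Dy Dz /lt_le_trans/(_ cd); exact: dP.
have d0 n : 0 < d n by case: (dP n).
exists (d 0%N) => // x y z; rewrite -ball_normE /= => xyz.
have e4 : 0 < e / 4 by exact: divr_gt0.
have room : 0 < d 0%N - `|amul x y - z| by rewrite subr_gt0.
have [h h0 hP] := amul_continuous_at x y room.
have [c [c0 ch ce]] := exists_pos_le2 h0 e4.
have [x0 Dx0 xx0] := dense_dist denseD x c0.
have [y0 Dy0 yy0] := dense_dist denseD y c0.
pose P n (p : L * L) := [/\ D p.1, D p.2 & `|amul p.1 p.2 - z| < d n].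
pose Q n (p q : L * L) := `|p.1 - q.1| < r n.+1 /\ `|p.2 - q.2| < r n.+1.
have P0 : P 0%N (x0, y0).
  split=> //=; rewrite -(subrKA (amul x y)) (le_lt_trans (ler_normD _ _))//.
  by rewrite -ltrBrDr distrC hP// (lt_le_trans _ ch).
have [n p [Dp1 Dp2 pz]|f [f0 fP]] := dependent_sequence (Q := Q) P0.
  have [_ _ np] := dP n.
  have [u [v [Du Dv pu pv uvz]]] := factor_step np (d0 n.+1) Dp1 Dp2 pz.
  by exists (u, v).
have limit (g : nat -> L) (w : L) : (forall n, `|g n - g n.+1| < r n.+1) ->
    `|w - g 0%N| < e / 4 ->
    exists2 l : L, `|w - l| < e & forall a, 0 < a ->
      exists N : nat, forall n, (N <= n)%N -> `|l - g n| < a.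
  move=> gr wg.
  have gr' n : `|g n - g n.+1| <= r n - r n.+1 by rewrite rS ltW.
  have /cvg_ex[l /cvgrPdist_lt gl] : cvg (g @ \oo).
    apply: cvg_telescope r0 _ gr' => a /rlt[N rN]; exists N; exact: rN.
  have gl' a : 0 < a -> exists N : nat, forall n, (N <= n)%N -> `|l - g n| < a.
    by move=> /gl[N _ NP]; exists N => n Nn; exact: NP.
  exists l => //; have [N /(_ N (leqnn N)) lN] := gl' _ e4.
  (* The three terms pay for the initial approximation, all the corrections, and the distance from
     [g N] to the limit. *)
  have -> : e = e / 4 + (r 0%N + e / 4) by rewrite /r expr0; field.
  rewrite -(subrKA (g 0%N)) (le_lt_trans (ler_normD _ _))// ltrD//.
  rewrite -(subrKA (g N)) (le_lt_trans (ler_normD _ _))// ler_ltD// 1?distrC//.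
  rewrite distrC (le_trans (telescope_norm gr' (leq0n N)))//.
  by rewrite gerBl ltW.
have [||x' xx' fx'] := limit (fun n => (f n).1) x.
- by move=> n; case: (fP n) => _ [].
- by rewrite f0 (lt_le_trans xx0).
have [||y' yy' fy'] := limit (fun n => (f n).2) y.
- by move=> n; case: (fP n) => _ [].
- by rewrite f0 (lt_le_trans yy0).
exists x' => //; exists y' => //.
(* If the distance [a] from [amul x' y'] to [z] were positive, it would be less than itself: for
   large [n], continuity of the product gives one [a / 2] and [d n <= r n] the other. *)
apply/eqP; rewrite -subr_eq0 -normr_eq0; apply/negP => /negP.
rewrite normr_eq0 -normr_gt0 => a0; set a := `|_| in a0.
have a20 : 0 < a / 2 by exact: divr_gt0.
have [k k0 kP] := amul_continuous_at x' y' a20.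
have [[N1 N1P] [N2 N2P]] := (fx' k k0, fy' k k0).
have [N3 N3P] := rlt _ a20.
pose n := maxn N1 (maxn N2 N3).
suff : a < a by rewrite ltxx.
rewrite [ltRHS]splitr {1}/a -(subrKA (amul (f n).1 (f n).2)).
rewrite (le_lt_trans (ler_normD _ _))// ltrD//.
  by rewrite kP ?N1P ?N2P// !leq_max leqnn ?orbT.
have [[_ _ fz] _] := fP n; have [_ dr _] := dP n.
by rewrite (lt_trans fz)// (le_lt_trans dr)// N3P// !leq_max leqnn !orbT.
Qed.

End OpenOnDenseSubset.

(** * Directed unions and completions *)

Lemma isometric_alg_hom_dist (K : numFieldType) (A B : normedAlgType K)
    (f : A -> B) (x y : A) :
  isometric_alg_hom f -> `|f x - f y| = `|x - y|.
Proof.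
case=> flin _ fnorm.
by rewrite -(fnorm (x - y)) addrC -scaleN1r -flin scaleN1r addrC.
Qed.

Lemma union_lift3 (K : numFieldType) (d : Order.disp_t)
    (Gamma : preorderType d) (A : Gamma -> normedAlgType K)
    (inc : forall g h : Gamma, (g <= h)%O -> A g -> A h)
    (U : normedAlgType K) (iota : forall g : Gamma, A g -> U) :
  directed_set Gamma -> is_union_algebra inc iota ->
  forall u v w : U, exists (g : Gamma) (a b c : A g),
    [/\ iota g a = u, iota g b = v & iota g c = w].
Proof.
move=> [_ dirG] [_ iota_inc iotaU] u v w.
have lift t : exists (g : Gamma) (a : A g), iota g a = t.
  have : [set: U] t by [].
  by rewrite -iotaU => -[g _ [a _ <-]]; exists g, a.
have [g1 [a <-]] := lift u; have [g2 [b <-]] := lift v.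
have [g3 [c <-]] := lift w.
have [h [g1h g2h]] := dirG g1 g2; have [k [hk g3k]] := dirG h g3.
exists k, (inc _ _ (le_trans g1h hk) a), (inc _ _ (le_trans g2h hk) b).
by exists (inc _ _ g3k c); rewrite !iota_inc.
Qed.

Lemma union_uniformly_open_mul (K : numFieldType) (d : Order.disp_t)
    (Gamma : preorderType d) (A : Gamma -> normedAlgType K)
    (inc : forall g h : Gamma, (g <= h)%O -> A g -> A h)
    (U : normedAlgType K) (iota : forall g : Gamma, A g -> U) :
  directed_set Gamma -> is_union_algebra inc iota ->
  equi_uniformly_open_mul A -> uniformly_open_mul U.
Proof.
move=> dirG unionU equiA e e0; have [dl dl0 dlP] := equiA e e0.
(* The same [dl] serves: the isometry [iota g] carries the hypothesis down to [A g] and the factors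
   back up. *)
exists dl => // u v w.
have [g [a [b [c [<- <- <-]]]]] := union_lift3 dirG unionU u v w.
have [/(_ g) iotaP _ _] := unionU; have [_ iotaM _] := iotaP.
rewrite -iotaM -ball_normE /= isometric_alg_hom_dist// => abc.
have [|a' aa' [b' bb' <-]] := dlP g a b c; first by rewrite -ball_normE.
move: aa' bb'; rewrite -!ball_normE /= => aa' bb'.
exists (iota g a'); first by rewrite /= isometric_alg_hom_dist.
by exists (iota g b'); rewrite /= ?isometric_alg_hom_dist// iotaM.
Qed.

Lemma completion_uniformly_open_mul (K : numFieldType) (U : normedAlgType K)
    (L : banachAlgType K) (kappa : U -> L) :
  archimedean_scalars K -> is_completion kappa ->
  uniformly_open_mul U -> uniformly_open_mul L.
Proof.
move=> archiK [kappaP denseU] openU.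
(* Here [D] is the image of [U], where openness is inherited through the isometry [kappa]. *)
apply: (uniformly_open_mul_dense archiK denseU) => e /openU[d d0 dP].
have [_ kappaM _] := kappaP.
exists d => // _ _ _ [x _ <-] [y _ <-] [z _ <-].
rewrite -kappaM isometric_alg_hom_dist// => xyz.
have [|u xu [v yv uvz]] := dP x y z; first by rewrite -ball_normE.
move: xu yv; rewrite -!ball_normE /= => xu yv.
exists (kappa u), (kappa v).
split; rewrite ?isometric_alg_hom_dist// -?kappaM ?uvz//; first by exists u.
by exists v.
Qed.

Theorem corollary3p6 (R : realType) (s : scalar_kind) (d : Order.disp_t)
    (Gamma : preorderType d) (A : Gamma -> banachAlgType (scalar_field R s))
    (inc : forall g h : Gamma, (g <= h)%O -> A g -> A h)
    (A_directed : directed_by_inclusion inc)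
    (A_equi : equi_uniformly_open_mul (fun g : Gamma => A g))
    (L : banachAlgType (scalar_field R s))
    (L_limit : is_direct_limit inc L) :
  uniformly_open_mul L.
Proof.
have [dirG _ _ _] := A_directed.
have [U [iota [kappa [unionU complU]]]] := L_limit.
apply: completion_uniformly_open_mul complU _.
  exact: scalar_field_archimedean.
exact: union_uniformly_open_mul dirG unionU A_equi.
Qed.
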